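(* Let $s\ge 2$ be an integer, and let $X$ and $Y$ be two connected graphs of order $n\ge 6$. (i) If $Y\cong K_n$, then $\mathrm{FS}(X,Y)$ is $\Delta(X)$-connected. (ii) If $Y\not\cong K_n$, $\delta(Y)\ge\delta(X)$ and $\Delta(X)+2\delta(Y)\ge 2n+s-2$, then $\mathrm{FS}(X,Y)$ is $(s+1)$-connected.
   Context: All graphs are finite and simple; the order of a graph is its number of vertices. For two graphs $X,Y$ of the same order $n$, the friends-and-strangers graph $\mathrm{FS}(X,Y)$ has as vertices all bijections $\sigma:V(X)\to V(Y)$; two bijections $\sigma,\sigma'$ are adjacent if and only if there are distinct $a,b\in V(X)$ with $ab\in E(X)$, $\sigma(a)\sigma(b)\in E(Y)$, $\sigma(a)=\sigma'(b)$, $\sigma(b)=\sigma'(a)$, and $\sigma(c)=\sigma'(c)$ for all $c\in V(X)\setminus\{a,b\}$. $\delta(G)$ and $\Delta(G)$ are the minimum and maximum degree of $G$. A graph $G$ is $s$-connected if it has more than $s$ vertices and removing any $s-1$ vertices leaves a connected graph. $K_n$ is the complete graph of order $n$. *)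

(* Defs.v *)
From mathcomp Require Import all_boot.

Set Implicit Arguments.
Unset Strict Implicit.
Unset Printing Implicit Defensive.

Record sgraph := SGraph {
  vertex :> finType;
  adj : rel vertex;
  adj_sym : symmetric adj;
  adj_irr : irreflexive adj
}.

Definition degree (G : sgraph) (x : G) : nat := #|[set y : G | adj x y]|.

Definition max_degree (G : sgraph) : nat := \max_(x : G) degree x.

(* Every degree is less than #|G|, so the default value #|G| never wins when G
   has a vertex. *)
Definition min_degree (G : sgraph) : nat := \big[minn/#|G|]_(x : G) degree x.

Definition connected (G : sgraph) : Prop :=
  0 < #|G| /\ forall x y : G, connect (@adj G) x y.

Definition graph_iso (G H : sgraph) : Prop :=
  exists2 f : G -> H, bijective f & forall x y : G, adj (f x) (f y) = adj x y.

Section Complete.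
Variable n : nat.
Definition complete_adj : rel 'I_n := fun i j => i != j.
Lemma complete_adj_sym : symmetric complete_adj.
Proof. by move=> i j; rewrite /complete_adj eq_sym. Qed.
Lemma complete_adj_irr : irreflexive complete_adj.
Proof. by move=> i; rewrite /complete_adj eqxx. Qed.
Definition complete_graph : sgraph := SGraph complete_adj_sym complete_adj_irr.
End Complete.

Section Delete.
Variables (G : sgraph) (S : {set G}).
Definition delete_adj : rel {x : G | x \notin S} :=
  fun x y => adj (val x) (val y).
Lemma delete_adj_sym : symmetric delete_adj.
Proof. by move=> x y; apply: adj_sym. Qed.
Lemma delete_adj_irr : irreflexive delete_adj.
Proof. by move=> x; apply: adj_irr. Qed.
Definition delete : sgraph := SGraph delete_adj_sym delete_adj_irr.
End Delete.

Definition k_connected (k : nat) (G : sgraph) : Prop :=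
  k < #|G| /\ forall S : {set G}, #|S|.+1 = k -> connected (delete S).

Section FriendsAndStrangers.
Variables X Y : sgraph.

Definition bijectiveb (f : {ffun X -> Y}) : bool :=
  injectiveb f && [forall y, exists x, f x == y].

Definition FS_adj : rel {f : {ffun X -> Y} | bijectiveb f} :=
  fun s t => [exists a : X, exists b : X,
    [&& a != b, adj a b, adj (val s a) (val s b),
        val s a == val t b, val s b == val t a &
        [forall c : X, (c != a) && (c != b) ==> (val s c == val t c)]]].

Lemma FS_adj_sym : symmetric FS_adj.
Proof.
have H s t : FS_adj s t -> FS_adj t s; last by move=> s t; apply/idP/idP; apply: H.
case/existsP=> a /existsP[b /andP[ab /and5P[Eab Est /eqP e1 /eqP e2 /forallP e3]]].
apply/existsP; exists a; apply/existsP; exists b.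
rewrite ab Eab -e1 -e2 adj_sym Est !eqxx /=.
by apply/forallP=> c; rewrite (eq_sym (val t c)); apply: e3.
Qed.

Lemma FS_adj_irr : irreflexive FS_adj.
Proof.
move=> s; apply/negbTE/negP; case/existsP=> a /existsP[b /andP[_ /and5P[_ Est /eqP e1 _ _]]].
by rewrite e1 adj_irr in Est.
Qed.

Definition FS : sgraph := SGraph FS_adj_sym FS_adj_irr.

End FriendsAndStrangers.

(* Main.v *)
Require Import Defs.
From mathcomp Require Import all_boot all_fingroup zify.

(** A bijection of [X] with [Y] becomes a permutation [s] of the vertices of [X]
    once [Y] is transported to [X]; a move replaces [s] by [tperm a b * s], where
    [a b] is an edge of [X] and [s a], [s b] are adjacent in [Y].  Let [v] be a
    vertex of maximal degree [D] in [X], and let [q] bound, for every vertex of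
    [Y], the number of vertices that are not adjacent to it, itself included.
    Both parts follow from one statement ([FS_k_connected]): if [2 q <= D], then
    deleting a set [S] of at most [D - max (2 q - 2) 1] states leaves the other
    states connected.  For [Y] complete, [q = 1] and [S] may have [D - 1]
    elements; otherwise [q = n - min_degree Y >= 2], and the degree condition
    allows [S] to have [s] elements.

    The vertices of [X] are added one at a time, starting from the star formed
    by [v] and its neighbours ([swap_delete]).  Let [x] be a new vertex, adjacent
    to [w] in the part [A] already handled.  The states on [x |: A] split into
    blocks according to the image of [x], and each block minus [S] is connected
    by the previous step.  Between the blocks of two adjacent images [y] and [y']
    there are [(#|A| - 1)!] disjoint edges, namely the swaps of [w] and [x] when
    the image of [w] is [y'].  This is more than [#|S|], so some edge survives;
    and two images which are not adjacent have common neighbours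
    ([glue_blocks]).

    The star is a sliding puzzle: the image of [v] is a hole moving along the
    edges of [Y], and the other vertices carry tiles ([star_delete]).  If [S] has
    at least three elements, one tile is frozen, the bound on [S] drops by one,
    and the same gluing applies, unless all of [S] lies in a single block.  In
    that case the other blocks are intact, and every state of the bad block can
    leave it: unless its hole is already next to the frozen tile, it has more than
    [#|S|] ways to move there.

    If [S] has at most two elements, the argument is direct.  Every edge of [Y]
    lies in a triangle and vertices that are not adjacent have at least three
    common neighbours.  Triangles produce transpositions of tiles, so that
    the whole puzzle is connected ([star_connect]).  A hole running around a
    triangle or a quadrangle traces a cycle of length 6 or 12 in the state graph,
    and these cycles give detours around the deleted states
    ([star_delete_le2]). *)

Set Implicit Arguments.
Unset Strict Implicit.
Unset Printing Implicit Defensive.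

(** * Connectivity after deletion of vertices *)

Definition avoiding (V : finType) (e : rel V) (S : {set V}) : rel V :=
  fun x y => [&& e x y, x \notin S & y \notin S].

Lemma avoiding_sym (V : finType) (e : rel V) (S : {set V}) :
  symmetric e -> symmetric (avoiding e S).
Proof. by move=> es x y; rewrite /avoiding es [(x \notin S) && _]andbC. Qed.

Lemma connect_avoiding_sym (V : finType) (e : rel V) (S : {set V}) :
  symmetric e -> connect_sym (avoiding e S).
Proof. by move=> es; apply: sym_connect_sym; apply: avoiding_sym. Qed.

Lemma connect_avoiding1 (V : finType) (e : rel V) (S : {set V}) x y :
  e x y -> x \notin S -> y \notin S -> connect (avoiding e S) x y.
Proof. by move=> exy xS yS; apply: connect1; rewrite /avoiding exy xS. Qed.

(** A path that meets [S] does so in runs of consecutive deleted vertices; as [S]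
    has at most two elements, a run stays in one vertex or one edge of [S].  The
    first hypothesis replaces a run through a single vertex, and together with
    the second one it replaces a run along an edge. *)
Lemma connect_reroute (V : finType) (e : rel V) (S : {set V}) :
    symmetric e -> #|S| <= 2 ->
    (forall u a b, u \in S -> e u a -> e u b -> a \notin S -> b \notin S ->
       connect (avoiding e S) a b) ->
    (forall u w, u \in S -> w \in S -> e u w ->
       exists a b, [/\ e u a, e w b, a \notin S, b \notin S &
                       connect (avoiding e S) a b]) ->
  forall x y, connect e x y -> x \notin S -> y \notin S ->
    connect (avoiding e S) x y.
Proof.
move=> es S2 H1 H2 x y /connectP[p].
(* While the path is inside [S], the invariant says that every way out of the
   current run leads to a vertex reachable from [x]. *)
pose inv z := (z \notin S -> connect (avoiding e S) x z) /\
  (z \in S -> forall u b, u \in S -> (u == z) || e z u -> b \notin S -> e u b ->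
     connect (avoiding e S) x b).
suff inv_path: forall p z, inv z -> path e z p -> inv (last z p).
  move=> ep -> xS yS; have [|//|+ _] := inv_path p x; last exact.
  by split=> [_|]; [apply: connect0 | rewrite (negPf xS)].
elim=> {p} [//|z' p IHp] z [inv1 inv2] /= /andP[ezz' ep].
apply: IHp ep; have [zS|zS] := boolP (z \in S); split=> z'S.
- by apply: (inv2 zS z) => //; rewrite eqxx.
- move=> u b uS uz' bS eub.
  have [u_z|u_z] := eqVneq u z; first by apply: (inv2 zS u b) => //; rewrite u_z eqxx.
  have [u_z'|u_z'] := eqVneq u z'.
    by apply: (inv2 zS u b) => //; rewrite u_z' ezz' orbT.
  have [zz'|zz'] := eqVneq z z'.
    by apply: (inv2 zS u b) => //; rewrite zz'.
  suff: 2 < #|S| by rewrite ltnNge S2.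
  rewrite (cardsD1 z) zS (cardsD1 z') (cardsD1 u) !inE.
  by rewrite u_z u_z' eq_sym zz' uS z'S.
- by apply: connect_trans (inv1 zS) _; apply: connect_avoiding1.
move=> u b uS uz' bS eub; apply: connect_trans (inv1 zS) _.
have ez'z: e z' z by rewrite es.
case/orP: uz' => [/eqP u_z'|ez'u]; first by apply: (H1 z') => //; rewrite -u_z'.
have [a [b' [ea eb' aS b'S ab']]] := H2 _ _ z'S uS ez'u.
apply: connect_trans (H1 z' z a z'S ez'z ea zS aS) _.
by apply: connect_trans ab' _; apply: (H1 u).
Qed.

(** * Permutations and swaps along edges *)

Section Swaps.
Variables (T : finType).
Implicit Types (a b p x : T) (s t : {perm T}) (A L : {set T}) (S : {set {perm T}}).

Definition swap_rel (eX eY : rel T) : rel {perm T} := fun s t =>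
  [exists a, exists b, [&& eX a b, eY (s a) (s b) & t == (tperm a b * s)%g]].

Definition agree_off A s t := forall x, x \notin A -> s x = t x.

Definition star v L : rel T := fun a b => (a == v) && (b \in L).

Lemma agree_off_sym A s t : agree_off A s t -> agree_off A t s.
Proof. by move=> st x xA; rewrite st. Qed.

Lemma agree_off_trans A s t r :
  agree_off A s t -> agree_off A t r -> agree_off A s r.
Proof. by move=> st tr x xA; rewrite st ?tr. Qed.

Lemma agree_off_tperm A a b s :
  a \in A -> b \in A -> agree_off A (tperm a b * s)%g s.
Proof.
move=> aA bA x xA; rewrite permM tpermD //.
  by apply: contraNneq xA => <-.
by apply: contraNneq xA => <-.
Qed.

Lemma agree_off_perm A s t : agree_off A s t ->
  forall a, a \in A -> exists2 b, b \in A & s b = t a.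
Proof.
move=> st a aA; exists ((s^-1)%g (t a)); last by rewrite permKV.
apply/negPn/negP=> bA; have := st _ bA; rewrite permKV => /perm_inj ab.
by rewrite -ab aA in bA.
Qed.

(** A disagreement of [s] with [t] at [a] is repaired by one transposition, and
    this creates no new disagreement. *)
Lemma agree_off_connect A (R : rel {perm T}) :
    connect_sym R ->
    (forall s a b, a \in A -> b \in A -> connect R s (tperm a b * s)%g) ->
  forall s t, agree_off A s t -> connect R s t.
Proof.
move=> Rs Rt s t; move: {2}#|_| (leqnn #|[set x | s x != t x]|) => k.
elim: k s => [|k IHk] s.
  rewrite leqn0 cards_eq0 => /eqP s0 _; suff ->: s = t by [].
  by apply/permP=> x; apply/eqP; move/setP/(_ x): s0; rewrite !inE => /negbFE.
move=> sk st; have [/eqP|[a]] := set_0Vmem [set x | s x != t x].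
  by rewrite -cards_eq0 => /eqP s0; apply: IHk => //; rewrite s0.
rewrite inE => sta.
have aA: a \in A by apply: contraNT sta => aA; rewrite st.
have [b bA sb] := agree_off_perm st aA.
apply: connect_trans (Rt s a b aA bA) _; apply: IHk; last first.
  by apply: agree_off_trans st; apply: agree_off_tperm.
rewrite -ltnS; apply: leq_trans sk; apply: proper_card; apply/properP; split.
  apply/subsetP=> x; rewrite !inE permM; case: tpermP => [->|->|] //.
  by move=> _; apply: contraNneq sta; rewrite sb => /perm_inj ab; rewrite {1}ab sb.
by exists a; rewrite !inE // permM tpermL sb eqxx.
Qed.

Variable eY : rel T.
Hypotheses (eY_sym : symmetric eY) (eY_irr : irreflexive eY).

Lemma swap_rel_tperm (eX : rel T) s a b :
  eX a b -> eY (s a) (s b) -> swap_rel eX eY s (tperm a b * s)%g.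
Proof.
by move=> ab sab; apply/existsP; exists a; apply/existsP; exists b; rewrite ab sab eqxx.
Qed.

Lemma swap_rel_sym (eX : rel T) : symmetric (swap_rel eX eY).
Proof.
suff H s t: swap_rel eX eY s t -> swap_rel eX eY t s.
  by move=> s t; apply/idP/idP; apply: H.
case/existsP=> a /existsP[b /and3P[ab sab /eqP->]].
have {2}->: s = (tperm a b * (tperm a b * s))%g by rewrite mulgA tperm2 mul1g.
by apply: swap_rel_tperm => //; rewrite !permM tpermL tpermR eY_sym.
Qed.

Lemma swap_rel_starP v L s t : swap_rel (star v L) eY s t ->
  exists a, [/\ a \in L, eY (s v) (s a) & t = (tperm v a * s)%g].
Proof.
by case/existsP=> a /existsP[b /and3P[/andP[/eqP-> bL] sab /eqP->]]; exists b.
Qed.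

Lemma swap_connect (eX : rel T) S s a b :
  eX a b -> eY (s a) (s b) -> s \notin S -> (tperm a b * s)%g \notin S ->
  connect (avoiding (swap_rel eX eY) S) s (tperm a b * s)%g.
Proof. by move=> ab sab *; apply: connect_avoiding1 => //; apply: swap_rel_tperm. Qed.

(** The products of one state having [w] at [s z] with the permutations fixing
    everything off [A :\ w] are [(#|A| - 1)!] states; the swap of [w] and [x]
    pairs them with states that send [x] elsewhere, so all these pairs are
    disjoint and [S] cannot meet each of them. *)
Lemma crossing_swap A S s x w z : x \notin A -> w \in A -> z \in A ->
    #|S| < (#|A|.-1)`! ->
  exists t, [/\ agree_off A s t, t w = s z, t \notin S & (tperm w x * t)%g \notin S].
Proof.
move=> xA wA zA Slt.
pose r (p : {perm T}) := (p * (tperm w z * s))%g.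
pose P := [set p : {perm T} | perm_on (A :\ w) p].
have cardP: #|P| = (#|A|.-1)`!.
  by rewrite cardsE card_perm; congr (_`!); rewrite [in RHS](cardsD1 w) wA.
have rP (p : {perm T}): p \in P -> agree_off A s (r p) /\ r p w = s z.
  rewrite inE => pA; split; last by rewrite !permM (out_perm pA) ?tpermL // !inE eqxx.
  move=> y yA; rewrite !permM (out_perm pA) ?inE ?(negPf yA) ?andbF //.
  by rewrite tpermD //; apply: contraNneq yA => <-.
have [/existsP[p /and3P[pP p1 p2]]|none] :=
  boolP [exists p : {perm T}, [&& p \in P, r p \notin S & (tperm w x * r p)%g \notin S]].
  by have [? ?] := rP p pP; exists (r p).
move: Slt; rewrite ltnNge -cardP => /negP[].
pose f (p : {perm T}) := if r p \in S then r p else (tperm w x * r p)%g.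
have r_inj: injective r by move=> ? ? /mulIg.
have rx (p : {perm T}): p \in P -> r p x = s x by case/rP=> ag _; rewrite -ag.
have rx' (p : {perm T}): p \in P -> (tperm w x * r p)%g x != s x.
  move=> pP; have [_ e] := rP p pP; rewrite permM tpermR e.
  by apply: contraNneq xA => /perm_inj <-.
have f_inj: {in P &, injective f}.
  move=> p p' pP p'P; rewrite /f; case: ifP => _; case: ifP => _.
  - by move/r_inj.
  - by move/permP/(_ x)/eqP; rewrite rx // eq_sym (negPf (rx' _ _)).
  - by move/permP/(_ x)/eqP; rewrite [r p' x]rx // (negPf (rx' _ _)).
  - by move/mulgI/r_inj.
rewrite -(card_in_imset f_inj); apply: subset_leq_card; apply/subsetP=> t.
case/imsetP=> p pP ->; rewrite /f; case: ifPn => // p1.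
apply: contraR none => p2; apply/existsP; exists p; by rewrite pP p1.
Qed.

Variable q : nat.
Hypothesis few_strangers : forall y, #|[set z | ~~ eY y z]| <= q.

(** Written in terms of the preimages by [s], since the argument keeps track of
    the vertices of [X] rather than of their images. *)
Definition strangers s p := [set a | ~~ eY (s p) (s a)].

Lemma card_strangers s p : #|strangers s p| <= q.
Proof.
apply: leq_trans (few_strangers (s p)); rewrite -(card_imset _ (@perm_inj _ s)).
apply: subset_leq_card; apply/subsetP=> y /imsetP[a]; rewrite /strangers inE => pa ->.
by rewrite inE.
Qed.

Lemma strangers_refl s p : p \in strangers s p.
Proof. by rewrite /strangers inE eY_irr. Qed.

Definition commons s p p' A := [set a in A | eY (s p) (s a) && eY (s p') (s a)].

Lemma card_commonsU s p p' A :
  #|A| <= #|commons s p p' A| + #|strangers s p :|: strangers s p'|.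
Proof.
rewrite -(cardsID (commons s p p' A) A); apply: leq_add.
  by apply: subset_leq_card; apply: subsetIr.
apply: subset_leq_card; apply/subsetP=> a; rewrite /commons /strangers !inE.
by case: (a \in A); rewrite //= andbT -negb_and.
Qed.

Lemma commons_exist s p p' A :
  q.*2 < #|A| -> exists2 a, a \in A & eY (s p) (s a) /\ eY (s p') (s a).
Proof.
move=> Aq; suff: commons s p p' A != set0.
  by case/set0Pn=> a; rewrite /commons inE => /and3P[aA pa p'a]; exists a.
rewrite -card_gt0; have := card_commonsU s p p' A.
have := card_strangers s p; have := card_strangers s p'.
rewrite cardsU; lia.
Qed.

(** The two vertices are strangers of each other, hence both are counted twice
    when the two sets of strangers are added; this saving of 2 makes the final
    bounds sharp enough. *)
Lemma card_commons s p p' A : p != p' -> ~~ eY (s p) (s p') ->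
  1 < q /\ #|A| <= #|commons s p p' A| + q.-1.*2.
Proof.
move=> pp' npp'; have := card_commonsU s p p' A.
have := card_strangers s p; have := card_strangers s p'.
have: 1 < #|strangers s p :&: strangers s p'|.
  rewrite (cardsD1 p) (cardsD1 p') /strangers !inE !eY_irr eq_sym pp' npp' /=.
  by rewrite eY_sym npp'.
have := subset_leq_card (subsetIl (strangers s p) (strangers s p')).
rewrite cardsU; lia.
Qed.

(** The set [bad] contains the image of [x] in the block, if any, that is not
    known to be connected; the path goes around it.  Two images that are not
    adjacent have at least three common neighbours, so one of them is outside
    [bad]. *)
Lemma glue_blocks A S (bad : {set T}) x w (R : rel {perm T}) :
    x \notin A -> w \in A -> q.*2 < #|A|.+1 -> #|bad| <= 1 -> #|S| < (#|A|.-1)`! ->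
    (forall s t, s \notin S -> t \notin S -> agree_off A s t -> s x \notin bad ->
       connect R s t) ->
    (forall s, s \notin S -> (tperm w x * s)%g \notin S -> eY (s w) (s x) ->
       connect R s (tperm w x * s)%g) ->
  forall s t, s \notin S -> t \notin S -> agree_off (x |: A) s t ->
    s x \notin bad -> t x \notin bad -> connect R s t.
Proof.
move=> xA wA Aq bad1 Slt inblock cross.
(* A surviving edge from the block of [s x] to the block of an adjacent image. *)
have hop s z: s \notin S -> s x \notin bad -> z \in A -> eY (s x) (s z) ->
  exists r, [/\ r \notin S, connect R s r, agree_off (x |: A) s r & r x = s z].
  move=> sS sb zA sz.
  have [t [st tw tS t'S]] := crossing_swap s xA wA zA Slt.
  have tx: t x = s x by rewrite st.
  exists (tperm w x * t)%g; split=> //; last by rewrite permM tpermR.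
    apply: connect_trans (inblock s t sS tS st sb) _; apply: cross => //.
    by rewrite tw tx eY_sym.
  move=> y; rewrite !inE negb_or => /andP[yx yA]; rewrite permM.
  by rewrite tpermD ?st 1?eq_sym //; apply: contraNneq yA => ->.
have same s t: s \notin S -> t \notin S -> agree_off (x |: A) s t ->
    s x \notin bad -> s x = t x -> connect R s t.
  move=> sS tS st sb sx; apply: inblock => // y yA.
  have [->//|yx] := eqVneq y x; apply: st; rewrite !inE negb_or yx //.
have preim s t: agree_off (x |: A) s t -> s x != t x ->
    exists2 z, z \in A & s z = t x.
  move=> st sx; have [|z zA sz] := agree_off_perm st (a := x); first exact: setU11.
  exists z => //; move: zA; rewrite !inE => /orP[/eqP zx|//].
  by rewrite -sz zx eqxx in sx.
have near s t: s \notin S -> t \notin S -> agree_off (x |: A) s t ->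
    s x \notin bad -> t x \notin bad -> eY (s x) (t x) -> connect R s t.
  move=> sS tS st sb tb sxt.
  have [|z zA sz] := preim s t st.
    by apply: contraTneq sxt => ->; rewrite eY_irr.
  rewrite -sz in sxt; have [r [rS sr ar rx]] := hop s z sS sb zA sxt.
  apply: connect_trans sr (same _ _ rS tS _ _ _); rewrite ?rx ?sz //.
  exact: agree_off_trans (agree_off_sym ar) st.
move=> s t sS tS st sb tb.
have [sx|sx] := eqVneq (s x) (t x); first exact: same.
have [|nst] := boolP (eY (s x) (t x)); first exact: near.
have [z zA sz] := preim s t st sx.
have xz: x != z by apply: contraNneq xA => ->.
have nsz: ~~ eY (s x) (s z) by rewrite sz.
have [q1] := card_commons (x |: A) xz nsz.
rewrite cardsU1 xA => Ac.
have: ~~ (commons s x z (x |: A) \subset s @^-1: bad).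
  apply/negP=> /subset_leq_card; rewrite card_preimset; last exact: perm_inj.
  lia.
case/subsetPn=> a; rewrite /commons !inE => /and3P[axA sxa sza] ab.
have aA: a \in A.
  by case/orP: axA => // /eqP ax; rewrite ax eY_irr in sxa.
have [r [rS sr ar rx]] := hop s a sS sb aA sxa.
apply: connect_trans sr _; apply: near => //; rewrite ?rx //.
  exact: agree_off_trans (agree_off_sym ar) st.
by rewrite eY_sym -sz.
Qed.

End Swaps.

Lemma exists_outside (T : finType) (B C : {set T}) :
  #|C| < #|B| -> exists2 a, a \in B & a \notin C.
Proof.
move=> CB; suff /subsetPn[a aB aC]: ~~ (B \subset C) by exists a.
by apply: contraTN CB => /subset_leq_card; rewrite -leqNgt.
Qed.

Lemma tperm_mulE (T : finType) (a b : T) (s : {perm T}) x :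
  (tperm a b * s)%g x = if x == a then s b else if x == b then s a else s x.
Proof.
rewrite permM; case: tpermP => [->|->|/eqP xa /eqP xb].
- by rewrite eqxx.
- by rewrite eqxx; case: eqP => [->|].
- by rewrite (negPf xa) (negPf xb).
Qed.

(** Compares two products of transpositions pointwise; [neqs] collects the
    equality tests, between the points being moved, that are known. *)
Ltac perm_eq_cases neqs :=
  let x := fresh "x" in let xE := fresh "xE" in
  apply/permP=> x; rewrite !tperm_mulE ?neqs;
  repeat (case: (x =P _) => [xE|_]; [rewrite ?xE|]; rewrite ?neqs).

Lemma mem_card_le2 (T : finType) (S : {set T}) x y z : #|S| <= 2 ->
  x \in S -> y \in S -> x != y -> z \in S -> (z == x) || (z == y).
Proof.
move=> S2 xS yS xy zS; apply: contraLR S2; rewrite negb_or -ltnNge => /andP[zx zy].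
by rewrite (cardsD1 x) xS (cardsD1 y) (cardsD1 z) !inE zx zy eq_sym xy yS zS.
Qed.

(** * The puzzle on a star: connectedness *)

Section Star.
Variables (T : finType) (eY : rel T) (q : nat) (v : T) (L : {set T}).
Hypotheses (eY_sym : symmetric eY) (eY_irr : irreflexive eY).
Hypothesis few_strangers : forall y, #|[set z | ~~ eY y z]| <= q.
Hypotheses (vL : v \notin L) (Lq : q.*2 <= #|L|).

Implicit Types (P Q Z W : T) (s t : {perm T}) (S : {set {perm T}}).

Let A := v |: L.
Let e := swap_rel (star v L) eY.

Local Notation mv a s := (tperm v a * s)%g.

Let cardA : #|A| = #|L|.+1. Proof. by rewrite cardsU1 vL. Qed.

Let leaf_neq P : P \in L -> (v == P = false) * (P == v = false).
Proof.
move=> PL; have /negPf vP: v != P by apply: contraNneq vL => ->.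
by rewrite [P == v]eq_sym vP.
Qed.

Let adj_neq s a b : eY (s a) (s b) -> (a == b = false) * (b == a = false).
Proof.
move=> sab; have /negPf ab: a != b by apply: contraTneq sab => ->; rewrite eY_irr.
by rewrite [b == a]eq_sym ab.
Qed.

Let leaf_of_adj s a : a \in A -> eY (s v) (s a) -> a \in L.
Proof. by case/setU1P=> [->|//]; rewrite eY_irr. Qed.

Let e_sym : symmetric e. Proof. exact: swap_rel_sym. Qed.

Lemma slide s a : a \in L -> eY (s v) (s a) -> e s (mv a s).
Proof. by move=> aL sa; apply: swap_rel_tperm; rewrite // /star eqxx. Qed.

(** When the hole runs around a triangle it meets the tiles in the order
    [P, Q, P]; the result is the transposition of [P] and [Q]. *)
Lemma half_hexagon s P Q : P \in L -> Q \in L ->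
    eY (s v) (s P) -> eY (s v) (s Q) -> eY (s P) (s Q) ->
  e (mv P s) (mv Q (mv P s)) /\ e (mv Q (mv P s)) (tperm P Q * s)%g.
Proof.
move=> PL QL svP svQ sPQ; have PQ := adj_neq sPQ.
have [vP vQ] := (leaf_neq PL, leaf_neq QL); split.
  by apply: slide => //; rewrite !tperm_mulE eqxx ?(vP, vQ, PQ).
have ->: (tperm P Q * s = mv P (mv Q (mv P s)))%g.
  by perm_eq_cases (eqxx, vP, vQ, PQ).
by apply: slide => //; rewrite !tperm_mulE ?(eqxx, vP, vQ, PQ) // eY_sym.
Qed.

(* If the third vertex of the triangle is next to the hole, the hole first moves
   there, and moves back at the end. *)
Let swap_adjacent_near s P Q Z : P \in L -> Q \in L -> Z \in A ->
    (Z == v) || eY (s v) (s Z) -> eY (s P) (s Q) -> eY (s P) (s Z) ->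
  eY (s Q) (s Z) -> connect e s (tperm P Q * s)%g.
Proof.
have tri (r : {perm T}) : P \in L -> Q \in L -> eY (r P) (r Q) -> eY (r P) (r v) ->
    eY (r Q) (r v) -> connect e r (tperm P Q * r)%g.
  move=> PL QL rPQ; rewrite eY_sym => rvP; rewrite eY_sym => rvQ.
  have [h1 h2] := half_hexagon PL QL rvP rvQ rPQ.
  apply: connect_trans (connect1 (slide PL rvP)) _.
  exact: connect_trans (connect1 h1) (connect1 h2).
move=> PL QL ZA /orP[/eqP->|vZ] PQ PZ QZ; first exact: tri.
have ZL := leaf_of_adj ZA vZ.
have [[vP vQ] [nPZ nQZ]] := ((leaf_neq PL, leaf_neq QL), (adj_neq PZ, adj_neq QZ)).
have nvZ := leaf_neq ZL; have nPQ := adj_neq PQ.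
apply: connect_trans (connect1 (slide ZL vZ)) _.
apply: connect_trans (tri _ PL QL _ _ _) _;
  rewrite ?tperm_mulE ?(eqxx, vP, vQ, nPZ, nQZ) //.
apply: connect1; rewrite e_sym.
have ->: (tperm P Q * mv Z s = mv Z (tperm P Q * s))%g.
  by perm_eq_cases (eqxx, vP, vQ, nPQ, nPZ, nQZ, nvZ).
by apply: slide => //; rewrite !tperm_mulE ?(eqxx, vP, vQ, nPQ, nPZ, nQZ, nvZ).
Qed.

Lemma swap_adjacent s P Q : P \in L -> Q \in L -> eY (s P) (s Q) ->
  connect e s (tperm P Q * s)%g.
Proof.
move=> PL QL PQ; have nPQ := adj_neq PQ.
have [|Z ZA [PZ QZ]] := @commons_exist _ _ _ few_strangers s P Q A; first by rewrite cardA.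
(* A hole far from [Z] first goes to a common neighbour of the hole and of [Z],
   along a tile other than [P] and [Q]. *)
have [vZ|] := boolP ((Z == v) || eY (s v) (s Z)).
  exact: (swap_adjacent_near PL QL ZA).
rewrite negb_or => /andP[Zv nvZ].
have vZ: v != Z by rewrite eq_sym.
have [q1] := card_commons eY_sym eY_irr few_strangers A vZ nvZ.
rewrite cardA => AC.
have [|W] := @exists_outside _ (commons eY s v Z A) [set P; Q].
  by rewrite cards2; clear -q1 AC Lq; lia.
rewrite /commons !inE negb_or => /andP[WA /andP[vW ZW]] /andP[WP WQ].
have WL: W \in L by apply: (leaf_of_adj (s := s)) => //; rewrite /A !inE.
have [[vP vQ] [nPZ nQZ]] := ((leaf_neq PL, leaf_neq QL), (adj_neq PZ, adj_neq QZ)).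
have [[wP wQ] [nvW nZW]] := ((negPf WP, negPf WQ), (leaf_neq WL, adj_neq ZW)).
apply: connect_trans (connect1 (slide WL vW)) _.
have simp := (eqxx, vP, vQ, nPQ, nPZ, nQZ, nvW, negPf Zv, wP, wQ, nZW,
   (eq_sym P W), (eq_sym Q W)).
apply: connect_trans (swap_adjacent_near (Z := Z) PL QL ZA _ _ _ _) _;
  rewrite ?tperm_mulE ?simp //.
  by rewrite eY_sym ZW.
apply: connect1; rewrite e_sym.
have ->: (tperm P Q * mv W s = mv W (tperm P Q * s))%g.
  by perm_eq_cases simp.
by apply: slide => //; rewrite !tperm_mulE ?simp.
Qed.

(** If [Z] is adjacent to both [P] and [Q], the transposition is a conjugate of
    an adjacent one. *)
Lemma swap_leaves s P Q : P \in L -> Q \in L -> connect e s (tperm P Q * s)%g.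
Proof.
move=> PL QL; have [->|nPQ] := eqVneq P Q; first by rewrite tperm1 mul1g.
have [|PQ] := boolP (eY (s P) (s Q)); first exact: swap_adjacent.
have [q1] := card_commons eY_sym eY_irr few_strangers A nPQ PQ.
rewrite cardA => AC.
have [|Z] := @exists_outside _ (commons eY s P Q A) [set v].
  by rewrite cards1; clear -q1 AC Lq; lia.
rewrite /commons !inE => /andP[/orP[/eqP->|ZL]]; first by rewrite eqxx.
case/andP=> PZ QZ _.
have simp := (eqxx, adj_neq PZ, adj_neq QZ, negPf nPQ, (eq_sym Q P)).
apply: connect_trans (swap_adjacent PL ZL PZ) _.
apply: connect_trans (swap_adjacent (s := (tperm P Z * s)%g) PL QL _) _.
  by rewrite !tperm_mulE ?simp eY_sym.
apply: connect_trans (swap_adjacent ZL QL _) _.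
  by rewrite !tperm_mulE ?simp.
rewrite (_ : (_ * _)%g = (tperm P Q * s)%g) //.
by perm_eq_cases simp.
Qed.

(** If the hole and [P] are not adjacent, take the tile [Z] on a common neighbour:
    once [P] and [Z] are exchanged, the hole moves along [P] and then [Z]. *)
Lemma swap_center s P : P \in L -> connect e s (mv P s).
Proof.
move=> PL; have [vP|vP] := boolP (eY (s v) (s P)); first exact/connect1/slide.
have nvP: v != P by rewrite leaf_neq.
have [q1] := card_commons eY_sym eY_irr few_strangers A nvP vP.
rewrite cardA => AC.
have [|Z] := @exists_outside _ (commons eY s v P A) set0.
  by rewrite cards0; clear -q1 AC Lq; lia.
rewrite /commons inE => /andP[ZA /andP[vZ PZ]] _.
have ZL := leaf_of_adj ZA vZ.
have simp := (eqxx, adj_neq vZ, adj_neq PZ, leaf_neq PL).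
apply: connect_trans (swap_leaves s PL ZL) _.
apply: connect_trans (connect1 (slide PL _)) _.
  by rewrite !tperm_mulE ?simp.
apply: connect_trans (connect1 (slide ZL _)) _.
  by rewrite !tperm_mulE ?simp eY_sym.
rewrite (_ : (_ * _)%g = (mv P s)%g) //.
by perm_eq_cases simp.
Qed.

Lemma star_connect s t : agree_off A s t -> connect e s t.
Proof.
apply: agree_off_connect => {s t}; first exact: sym_connect_sym.
move=> s a b /setU1P[->|aL] /setU1P[->|bL].
- by rewrite tperm1 mul1g.
- exact: swap_center.
- by rewrite tpermC; apply: swap_center.
- exact: swap_leaves.
Qed.

(** * Detours around deleted states *)

(** When the hole runs twice around a triangle, the state describes a 6-cycle.
    In the three states other than [s] and its two neighbours on the cycle, both
    [P] and [Q] are displaced. *)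
Lemma hexagon S s P Q : P \in L -> Q \in L ->
    eY (s v) (s P) -> eY (s v) (s Q) -> eY (s P) (s Q) ->
    mv Q s \notin S ->
    (forall t, t P != s P -> t Q != s Q -> agree_off [set v; P; Q] t s -> t \notin S) ->
  [/\ e (mv P s) (mv Q (mv P s)), mv Q (mv P s) \notin S &
      connect (avoiding e S) (mv Q (mv P s)) (mv Q s)].
Proof.
move=> PL QL vP vQ PQ QS avoid.
have [h1 h2] := half_hexagon PL QL vP vQ PQ.
have [|h3 h4] := half_hexagon QL PL vQ vP; first by rewrite eY_sym.
have simp := (eqxx, leaf_neq PL, leaf_neq QL, adj_neq PQ, adj_neq vP, adj_neq vQ).
have off t : (forall x, ~~ ((x == v) || (x == P) || (x == Q)) -> t x = s x) ->
    agree_off [set v; P; Q] t s.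
  by move=> ts x; rewrite !inE; apply: ts.
have inner1: mv Q (mv P s) \notin S.
  apply: avoid; rewrite ?tperm_mulE ?simp ?(inj_eq perm_inj) ?simp //.
  apply: off => x xC; rewrite !tperm_mulE.
  by case/norP: xC => /norP[/negPf xv /negPf->] /negPf->; rewrite ?xv.
have inner2: (tperm P Q * s)%g \notin S.
  apply: avoid; rewrite ?tperm_mulE ?simp ?(inj_eq perm_inj) ?simp //.
  apply: off => x xC; rewrite !tperm_mulE.
  by case/norP: xC => /norP[/negPf xv /negPf->] /negPf->; rewrite ?xv.
have inner3: mv P (mv Q s) \notin S.
  apply: avoid; rewrite ?tperm_mulE ?simp ?(inj_eq perm_inj) ?simp //.
  apply: off => x xC; rewrite !tperm_mulE.
  by case/norP: xC => /norP[/negPf xv /negPf->] /negPf->; rewrite ?xv.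
split=> //; apply: connect_trans (connect_avoiding1 h2 inner1 inner2) _.
rewrite (connect_avoiding_sym S e_sym) (tpermC P).
rewrite (tpermC P) in inner2.
by apply: connect_trans (connect_avoiding1 h3 QS inner3) _; apply: connect_avoiding1.
Qed.

(* The moves along the quadrangle only permute these four values, so that a long
   walk can be followed without composing transpositions. *)
Let conf s P Z Q t b p z r :=
  [/\ t v = b, t P = p, t Z = z, t Q = r & agree_off (v |: [set P; Z; Q]) t s].

(** When the hole runs three times around the quadrangle formed by [v], [P], [Z]
    and [Q], the state describes a 12-cycle.  As the cyclic order of the three
    tiles never changes, [Z] is at its original place only in [s] and in the two
    neighbours of [s] on the cycle. *)
Lemma dodecagon S s P Z Q :
    P \in L -> Z \in L -> Q \in L -> P != Q ->
    eY (s v) (s P) -> eY (s v) (s Q) -> eY (s P) (s Z) -> eY (s Q) (s Z) ->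
    mv P s \notin S -> mv Q s \notin S ->
    (forall t, t Z != s Z -> agree_off (v |: [set P; Z; Q]) t s -> t \notin S) ->
  connect (avoiding e S) (mv P s) (mv Q s).
Proof.
move=> PL ZL QL nPQ vP vQ PZ QZ PS QS avoid.
have simp := (eqxx, leaf_neq PL, leaf_neq QL, leaf_neq ZL, adj_neq PZ, adj_neq QZ,
   negPf nPQ, eq_sym Q P).
have off t a : a \in [set P; Z; Q] -> agree_off (v |: [set P; Z; Q]) t s ->
    agree_off (v |: [set P; Z; Q]) (mv a t) s.
  move=> aC ts; apply: agree_off_trans ts; apply: agree_off_tperm.
    exact: setU11.
  exact: setU1r.
have stepP t b p z r : conf s P Z Q t b p z r -> conf s P Z Q (mv P t) p b z r.
  by case=> <- <- <- <- ts; split; rewrite ?tperm_mulE ?simp //;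
     apply: off; rewrite ?inE ?eqxx.
have stepZ t b p z r : conf s P Z Q t b p z r -> conf s P Z Q (mv Z t) z p b r.
  by case=> <- <- <- <- ts; split; rewrite ?tperm_mulE ?simp //;
     apply: off; rewrite ?inE ?eqxx ?orbT.
have stepQ t b p z r : conf s P Z Q t b p z r -> conf s P Z Q (mv Q t) r p z b.
  by case=> <- <- <- <- ts; split; rewrite ?tperm_mulE ?simp //;
     apply: off; rewrite ?inE ?eqxx ?orbT.
have c: conf s P Z Q s (s v) (s P) (s Z) (s Q) by split.
have moveP t b p z r : conf s P Z Q t b p z r -> eY b p -> t \notin S ->
    mv P t \notin S -> connect (avoiding e S) t (mv P t).
  by case=> <- <- _ _ _ *; apply: connect_avoiding1 => //; apply: slide.
have moveZ t b p z r : conf s P Z Q t b p z r -> eY b z -> t \notin S ->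
    mv Z t \notin S -> connect (avoiding e S) t (mv Z t).
  by case=> <- _ <- _ _ *; apply: connect_avoiding1 => //; apply: slide.
have moveQ t b p z r : conf s P Z Q t b p z r -> eY b r -> t \notin S ->
    mv Q t \notin S -> connect (avoiding e S) t (mv Q t).
  by case=> <- _ _ <- _ *; apply: connect_avoiding1 => //; apply: slide.
have inner t b p z r : conf s P Z Q t b p z r -> z != s Z -> t \notin S.
  by case=> _ _ <- _ ts tZ; apply: avoid.
have [c0 cQ] := (stepP _ _ _ _ _ c, stepQ _ _ _ _ _ c).
have c1 := stepZ _ _ _ _ _ c0; have c2 := stepQ _ _ _ _ _ c1.
have c3 := stepP _ _ _ _ _ c2; have c4 := stepZ _ _ _ _ _ c3.
have c5 := stepQ _ _ _ _ _ c4; have c6 := stepP _ _ _ _ _ c5.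
have c7 := stepZ _ _ _ _ _ c6; have c8 := stepQ _ _ _ _ _ c7.
have c9 := stepP _ _ _ _ _ c8; have c10 := stepZ _ _ _ _ _ c9.
have neq a b : a != b -> s a != s b by rewrite (inj_eq perm_inj).
have i1 := inner _ _ _ _ _ c1 (neq _ _ (negbT (adj_neq PZ).1)).
have i2 := inner _ _ _ _ _ c2 (neq _ _ (negbT (adj_neq PZ).1)).
have i3 := inner _ _ _ _ _ c3 (neq _ _ (negbT (adj_neq PZ).1)).
have i4 := inner _ _ _ _ _ c4 (neq _ _ (negbT (leaf_neq ZL).1)).
have i5 := inner _ _ _ _ _ c5 (neq _ _ (negbT (leaf_neq ZL).1)).
have i6 := inner _ _ _ _ _ c6 (neq _ _ (negbT (leaf_neq ZL).1)).
have i7 := inner _ _ _ _ _ c7 (neq _ _ (negbT (adj_neq QZ).1)).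
have i8 := inner _ _ _ _ _ c8 (neq _ _ (negbT (adj_neq QZ).1)).
have i9 := inner _ _ _ _ _ c9 (neq _ _ (negbT (adj_neq QZ).1)).
have [ZP ZQ] : eY (s Z) (s P) /\ eY (s Z) (s Q) by rewrite !(eY_sym (s Z)).
have [Pv Qv] : eY (s P) (s v) /\ eY (s Q) (s v) by rewrite !(eY_sym _ (s v)).
(* The closed walk of twelve moves starts with [P] and ends with [Q]. *)
have e10 : mv Z (mv P (mv Q (mv Z (mv P (mv Q (mv Z (mv P (mv Q (mv Z
    (mv P s)))))))))) = mv Q s.
  apply/permP=> x; have [xC|xC] := boolP (x \in v |: [set P; Z; Q]); last first.
    by case: c10 => _ _ _ _ ->; case: cQ => // _ _ _ _ ->.
  case: c10 => tv tP tZ tQ _; case: cQ => uv uP uZ uQ _.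
  by move: xC; rewrite !inE => /orP[|/orP[/orP[]|]] /eqP->; congruence.
apply: connect_trans (moveZ _ _ _ _ _ c0 PZ PS i1) _.
apply: connect_trans (moveQ _ _ _ _ _ c1 ZQ i1 i2) _.
apply: connect_trans (moveP _ _ _ _ _ c2 Qv i2 i3) _.
apply: connect_trans (moveZ _ _ _ _ _ c3 vP i3 i4) _.
apply: connect_trans (moveQ _ _ _ _ _ c4 PZ i4 i5) _.
apply: connect_trans (moveP _ _ _ _ _ c5 ZQ i5 i6) _.
apply: connect_trans (moveZ _ _ _ _ _ c6 Qv i6 i7) _.
apply: connect_trans (moveQ _ _ _ _ _ c7 vP i7 i8) _.
apply: connect_trans (moveP _ _ _ _ _ c8 PZ i8 i9) _.
by rewrite -e10; apply: (moveZ _ _ _ _ _ c9 ZQ i9); rewrite e10.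
Qed.

(** Tiles at adjacent places may have only one detour, the 6-cycle, and the last
    hypothesis keeps it open.  Otherwise there are two 12-cycles, through tiles
    [Z] and [W], and they share only [u] and the two states to be linked, so one
    of them avoids the second deleted state. *)
Lemma link_open S u P Q : #|S| <= 2 -> u \in S ->
    P \in L -> Q \in L -> eY (u v) (u P) -> eY (u v) (u Q) ->
    mv P u \notin S -> mv Q u \notin S ->
    (forall t, t \in S -> t P != u P -> t Q != u Q ->
       agree_off [set v; P; Q] t u -> ~~ eY (u P) (u Q)) ->
  connect (avoiding e S) (mv P u) (mv Q u).
Proof.
move=> S2 uS PL QL vP vQ PS QS open.
have [->//|nPQ] := eqVneq P Q.
have [PQ|PQ] := boolP (eY (u P) (u Q)).
  have [|h1 iS h2] := hexagon PL QL vP vQ PQ QS.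
    move=> t tP tQ toff; apply/negP=> tS.
    by have := open t tS tP tQ toff; rewrite PQ.
  by apply: connect_trans h2; apply: connect_avoiding1.
have [q1] := card_commons eY_sym eY_irr few_strangers A nPQ PQ.
rewrite cardA => AC.
have leafc Z : Z \in commons eY u P Q A -> Z != v ->
    [/\ Z \in L, eY (u P) (u Z) & eY (u Q) (u Z)].
  rewrite /commons inE => /and3P[+ PZ QZ] Zv.
  by rewrite /A in_setU1 (negPf Zv).
have [|Z ZC] := @exists_outside _ (commons eY u P Q A) [set v].
  by rewrite cards1; clear -q1 AC Lq; lia.
rewrite !inE => /(leafc _ ZC)[ZL PZ QZ].
have [|W WC] := @exists_outside _ (commons eY u P Q A) [set v; Z].
  by rewrite cards2; clear -q1 AC Lq; lia.
rewrite !inE negb_or => /andP[/(leafc _ WC)[WL PW QW] WZ].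
have [/existsP[t /and3P[tS tZ /eqP tW]]|none] :=
  boolP [exists t : {perm T}, [&& t \in S, t Z != u Z & t W == u W]].
  have ut: u != t by apply: contraNneq tZ => ->.
  apply: (dodecagon PL WL QL) => // r rW _; apply/negP=> rS.
  have /orP[] := mem_card_le2 S2 uS tS ut rS => /eqP rE; move: rW; rewrite rE ?eqxx //.
  by rewrite tW eqxx.
apply: (dodecagon PL ZL QL) => // r rZ roff; apply: contra none => rS.
apply/existsP; exists r; rewrite rS rZ roff //=.
by rewrite !inE !negb_or WZ (leaf_neq WL) (adj_neq PW) (adj_neq QW).
Qed.

(** The second deleted state blocks the 6-cycle of at most one pair [P], [Q] of
    tiles; in that case, the detour passes through the neighbour of [u] given by
    a third tile [R] next to the hole. *)
Lemma link_neighbors S u P Q : #|S| <= 2 -> #|S| + maxn q.-1.*2 1 <= #|L| ->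
    u \in S -> P \in L -> Q \in L -> eY (u v) (u P) -> eY (u v) (u Q) ->
    mv P u \notin S -> mv Q u \notin S ->
  connect (avoiding e S) (mv P u) (mv Q u).
Proof.
move=> S2 SL uS PL QL vP vQ PS QS.
have [/existsP[t /and4P[tS tP tQ /forallP toff]]|none] := boolP [exists t : {perm T},
   [&& t \in S, t P != u P, t Q != u Q &
       [forall x, (x \notin [set v; P; Q]) ==> (t x == u x)]]]; last first.
  apply: link_open => // t tS tP tQ toff; case/negP: none; apply/existsP; exists t.
  by rewrite tS tP tQ; apply/forallP=> x; apply/implyP=> /toff ->.
have ut: u != t by apply: contraNneq tP => ->.
have onlyS r : r \in S -> (r == u) || (r == t) by apply: mem_card_le2.
pose N := [set a in L | eY (u v) (u a)].
(* The hole is one of its own strangers, but it is not in [L]. *)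
have NL: #|L| <= #|N| + q.-1.
  rewrite -(cardsID N L); apply: leq_add.
    by apply: subset_leq_card; apply: subsetIr.
  have := card_strangers few_strangers u v.
  rewrite (cardsD1 v) strangers_refl // => Nq.
  apply: leq_trans (_ : q - 1 <= _); last by rewrite subn1.
  rewrite leq_subRL; last by apply: leq_trans Nq; clear; lia.
  apply: leq_trans Nq; rewrite leq_add2l; apply: subset_leq_card.
  apply/subsetP=> a; rewrite /strangers !inE => /andP[+ aL].
  by rewrite aL (leaf_neq aL).
have S_gt1: 1 < #|S| by rewrite (cardsD1 u) uS (cardsD1 t) !inE eq_sym ut tS.
have [|R RN] := @exists_outside _ N [set P; Q].
  by rewrite cards2; clear -S_gt1 SL Lq NL; lia.
rewrite !inE negb_or => /andP[RP RQ].
move: RN; rewrite inE => /andP[RL vR].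
have tR: t R = u R.
  by apply/eqP; move/implyP: (toff R); apply; rewrite !inE !negb_or RP RQ (leaf_neq RL).
have RS: mv R u \notin S.
  apply/negP=> /onlyS /orP[] /eqP/permP.
    by move/(_ v)/eqP; rewrite tperm_mulE eqxx (inj_eq perm_inj) (leaf_neq RL).
  move/(_ P); rewrite tperm_mulE (leaf_neq PL) eq_sym (negPf RP) => uP.
  by rewrite -uP eqxx in tP.
have clear r : r \in S -> r R != u R -> False.
  by move=> /onlyS /orP[] /eqP->; rewrite ?tR eqxx.
apply: connect_trans (_ : connect _ (mv R u) _).
  by apply: link_open => // r rS _ /(clear r rS).
by apply: link_open => // r rS /(clear r rS).
Qed.

(** For two deleted states that differ by a move of [P], the detour uses the
    6-cycle of a triangle containing this move. *)
Lemma star_delete_le2 S s t : #|S| <= 2 -> #|S| + maxn q.-1.*2 1 <= #|L| ->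
    s \notin S -> t \notin S -> agree_off A s t ->
  connect (avoiding e S) s t.
Proof.
move=> S2 SL sS tS /star_connect st; move: st sS tS.
apply: connect_reroute => // [u a b uS|u w uS wS].
  move=> /swap_rel_starP[P [PL vP ->]] /swap_rel_starP[Q [QL vQ ->]].
  exact: link_neighbors.
move=> /swap_rel_starP[P [PL vP wE]].
have [|Q QA [vQ PQ]] := @commons_exist _ _ _ few_strangers u v P A.
  by rewrite cardA.
have QL := leaf_of_adj QA vQ.
have uw: u != w.
  apply/eqP=> /permP/(_ v); rewrite wE tperm_mulE eqxx => /perm_inj/eqP.
  by rewrite (leaf_neq PL).
have onlyS r : r \in S -> (r == u) || (r == w) by apply: mem_card_le2.
have simp := (eqxx, leaf_neq PL, leaf_neq QL, adj_neq PQ).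
have QS: mv Q u \notin S.
  apply/negP=> /onlyS /orP[] /eqP/permP/(_ v)/eqP; rewrite ?wE !tperm_mulE eqxx.
    by rewrite (inj_eq perm_inj) ?simp.
  by rewrite (inj_eq perm_inj) ?simp.
have [|h1 bS h2] := hexagon PL QL vP vQ PQ QS.
  move=> r rP rQ _; apply/negP=> /onlyS /orP[] /eqP rE.
    by rewrite rE eqxx in rP.
  by move: rQ; rewrite rE wE tperm_mulE ?simp.
exists (mv Q u), (mv Q (mv P u)); split=> //.
- exact: slide.
- by rewrite wE.
- by rewrite (connect_avoiding_sym S e_sym).
Qed.

End Star.

Lemma connect_lift (V : finType) (e1 e2 : rel V) (I : pred V) x y :
    I x -> (forall z z', I z -> e1 z z' -> e2 z z' && I z') ->
  connect e1 x y -> connect e2 x y.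
Proof.
move=> Ix lift /connectP[p + ->] {y}; elim: p x Ix => [|z p IHp] x Ix /=.
  by rewrite connect0.
case/andP=> /(lift _ _ Ix)/andP[xz Iz] zp.
by apply: connect_trans (connect1 xz) _; apply: IHp.
Qed.

(** * The puzzle on a star: deletion of states *)

Section StarDeletion.
Variables (T : finType) (eY : rel T) (q : nat) (v : T).
Hypotheses (eY_sym : symmetric eY) (eY_irr : irreflexive eY).
Hypothesis few_strangers : forall y, #|[set z | ~~ eY y z]| <= q.
Implicit Types (s t r : {perm T}).

(** Freezing one tile [x] divides the puzzle into blocks.  Those containing only
    a part of [S] are connected by induction, since [#|S|] and [#|L|] both
    decrease; a block containing the whole of [S] is bad. *)
Theorem star_delete (L : {set T}) (S : {set {perm T}}) :
    v \notin L -> q.*2 <= #|L| -> #|S| + maxn q.-1.*2 1 <= #|L| ->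
  forall s t, s \notin S -> t \notin S -> agree_off (v |: L) s t ->
    connect (avoiding (swap_rel (star v L) eY) S) s t.
Proof.
move: {2}#|L| (leqnn #|L|) => k; elim: k L S => [|k IHk] L S Lk vL Lq SL.
  by move=> *; apply: (star_delete_le2 eY_sym eY_irr few_strangers) => //; lia.
have [S2|S3] := leqP #|S| 2; first by move=> *; apply: (star_delete_le2 eY_sym eY_irr few_strangers).
set e := swap_rel _ _.
have e_sym : symmetric e by apply: swap_rel_sym.
have slideL s a : a \in L -> eY (s v) (s a) -> e s (tperm v a * s)%g by apply: slide.
have /card_gt0P[x xL] : 0 < #|L| by lia.
have vx: v != x by apply: contraNneq vL => ->.
pose L' := L :\ x; pose A' := v |: L'.
have cardL: #|L| = #|L'|.+1 by rewrite (cardsD1 x) xL.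
have SL': #|S| <= #|L'| by clear -SL cardL; lia.
have L'3: 2 < #|L'| by clear -SL' S3; lia.
have vL': v \notin L' by rewrite !inE (negPf vL) andbF.
have cardA': #|A'| = #|L'|.+1 by rewrite cardsU1 vL'.
have xA': x \notin A' by rewrite !inE eq_sym (negPf vx) eqxx.
have AE: x |: A' = v |: L by rewrite setUCA setD1K.
pose bad := [set y | S \subset [set s : {perm T} | s x == y]].
have /card_gt0P[s0 s0S] : 0 < #|S| by lia.
have badP y : y \in bad -> forall s, s \in S -> s x = y.
  by rewrite inE => /subsetP Sy s /Sy; rewrite inE => /eqP.
have bad1: #|bad| <= 1.
  rewrite -(cards1 (s0 x)); apply: subset_leq_card; apply/subsetP=> y yb.
  by rewrite inE (badP y yb s0).
have fact_gt n : 2 < n -> n < n`!.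
  case: n => [|[|n]] // n0; rewrite factS ltn_Pmulr // ?factS.
  by have := fact_gt0 n; move: n0; clear; nia.
have inblock s t : s \notin S -> t \notin S -> agree_off A' s t -> s x \notin bad ->
    connect (avoiding e S) s t.
  move=> sS tS st sb; pose S' := [set r in S | r x == s x].
  have S'S: #|S'| < #|S|.
    apply: proper_card; apply/properP; split.
      by apply/subsetP=> r; rewrite inE => /andP[].
    move: sb; rewrite inE => /subsetPn[r rS]; rewrite inE => rx; exists r => //.
    by rewrite inE rS.
  have nS' r : r \notin S -> r \notin S' by apply: contra; rewrite inE => /andP[].
  apply: (@connect_lift _ (avoiding (swap_rel (star v L') eY) S') _ (fun r => r x == s x)) => //.
    move=> r r' rx /and3P[/swap_rel_starP[a [aL' va ->]] rS' r'S'].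
    have [ax aL] : a != x /\ a \in L by move: aL'; rewrite !inE => /andP[].
    have r'x: (tperm v a * r)%g x == s x.
      by rewrite tperm_mulE (eq_sym x v) (negPf vx) (eq_sym x a) (negPf ax).
    rewrite /avoiding r'x slideL //= andbT.
    by move: rS' r'S'; rewrite !inE rx r'x !andbT => -> ->.
  by apply: IHk; rewrite ?nS' //; clear -Lk Lq SL S3 S'S cardL; lia.
have cross s : s \notin S -> (tperm v x * s)%g \notin S -> eY (s v) (s x) ->
    connect (avoiding e S) s (tperm v x * s)%g.
  by move=> *; apply: connect_avoiding1 => //; apply: slideL.
have glue : forall s t, s \notin S -> t \notin S -> agree_off (v |: L) s t ->
    s x \notin bad -> t x \notin bad -> connect (avoiding e S) s t.
  rewrite -AE; apply: (glue_blocks eY_sym eY_irr few_strangers) inblock cross => //.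
  - exact: setU11.
  - by rewrite cardA'; lia.
  - by rewrite cardA' /=; apply: leq_ltn_trans SL' (fact_gt _ L'3).
(* If the hole is next to [x], moving it to [x] leaves the bad block. *)
have exit_near s : s \notin S -> s x \in bad -> eY (s v) (s x) ->
    exists r, [/\ r \notin S, connect (avoiding e S) s r,
                  agree_off (v |: L) s r & r x \notin bad].
  move=> sS sb svx; have nvx: s v != s x by rewrite (inj_eq perm_inj).
  have rx: (tperm v x * s)%g x = s v by rewrite permM tpermR.
  have rS: (tperm v x * s)%g \notin S.
    by apply: contraNN nvx => /(badP _ sb) <-; rewrite rx.
  exists (tperm v x * s)%g; split=> //; first exact: cross.
    by apply/agree_off_sym/agree_off_tperm; [apply: setU11 | apply: setU1r].
  by rewrite rx; apply: contraNN nvx => /badP/(_ _ s0S) <-; rewrite (badP _ sb _ s0S).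
(* Otherwise the hole first goes next to [x]; the number of ways to do so
   exceeds [#|S|]. *)
have exit s : s \notin S -> exists r, [/\ r \notin S, connect (avoiding e S) s r,
                  agree_off (v |: L) s r & r x \notin bad].
  move=> sS; have [sb|sb] := boolP (s x \in bad); last by exists s; split.
  have [svx|svx] := boolP (eY (s v) (s x)); first exact: exit_near.
  have [q1] := card_commons eY_sym eY_irr few_strangers (v |: L) vx svx.
  rewrite cardsU1 vL /= add1n => Lc.
  have Sc: #|S| < #|commons eY s v x (v |: L)| by clear -SL Lc; lia.
  pose mv a := (tperm v a * s)%g.
  have [a aC aS]: exists2 a, a \in commons eY s v x (v |: L) & mv a \notin S.
    have [|r] := @exists_outside _ (mv @: commons eY s v x (v |: L)) S.
      rewrite card_imset; first exact: Sc.
      by move=> a b /mulIg/permP/(_ v); rewrite !tpermL.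
    by case/imsetP=> a aC ->; exists a.
  move: aC; rewrite /commons inE in_setU1 => /and3P[aL sva sxa].
  have {}aL: a \in L.
    by case/orP: aL => // /eqP av; rewrite av eY_irr in sva.
  have xa: x != a by apply: contraTneq sxa => ->; rewrite eY_irr.
  have mx: mv a x = s x by rewrite tperm_mulE (eq_sym x v) (negPf vx) (negPf xa).
  have [||r [rS ar rag rb]] := exit_near (mv a) aS.
  - by rewrite mx.
  - by rewrite mx permM tpermL eY_sym.
  exists r; split=> //.
    by apply: connect_trans ar; apply: connect_avoiding1 => //; apply: slideL.
  apply: agree_off_trans rag; apply/agree_off_sym/agree_off_tperm; first exact: setU11.
  exact: setU1r.
move=> s t sS tS st.
have [s' [s'S ss' sag s'b]] := exit s sS; have [t' [t'S tt' tag t'b]] := exit t tS.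
apply: connect_trans ss' _; rewrite (connect_avoiding_sym S e_sym).
apply: connect_trans tt' _; apply: glue => //.
apply: agree_off_trans (agree_off_sym tag) _.
exact: agree_off_trans (agree_off_sym st) sag.
Qed.

End StarDeletion.

(** * From the star to a connected graph *)

Lemma exit_edge (T : finType) (e : rel T) (A : {set T}) a :
    symmetric e -> (forall x y, connect e x y) -> a \in A -> A != setT ->
  exists w x, [/\ w \in A, x \notin A & e w x].
Proof.
move=> e_sym conn aA AT.
have [/existsP[w /existsP[x /and3P[wA xA wx]]]|none] :=
  boolP [exists w, exists x, [&& w \in A, x \notin A & e w x]]; first by exists w, x.
case/eqP: AT; apply/setP=> b; rewrite in_setT.
have Aclosed: closed e A.
  have sub x y : e x y -> x \in A -> y \in A.
    by move=> exy xA; apply/negPn/negP=> yA; case/existsP: none; exists x;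
    apply/existsP; exists y; rewrite xA yA.
  by move=> x y exy; apply/idP/idP; apply: sub; rewrite // e_sym.
by rewrite -(closed_connect Aclosed (conn a b)).
Qed.

Section SwapDeletion.
Variables (T : finType) (eX eY : rel T) (q : nat) (v : T) (S : {set {perm T}}).
Hypotheses (eX_sym : symmetric eX) (eX_irr : irreflexive eX).
Hypothesis eX_connected : forall x y, connect eX x y.
Hypotheses (eY_sym : symmetric eY) (eY_irr : irreflexive eY).
Hypothesis few_strangers : forall y, #|[set z | ~~ eY y z]| <= q.

Let N := [set a | eX v a].

Hypotheses (Nq : q.*2 <= #|N|) (SN : #|S| + maxn q.-1.*2 1 <= #|N|).

(** A part of [X] is linked when the states agreeing off it are connected after
    the deletion of [S]; being linked passes from the star at [v] to larger
    parts by adjoining one vertex at a time. *)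
Theorem swap_delete (s t : {perm T}) : s \notin S -> t \notin S ->
  connect (avoiding (swap_rel eX eY) S) s t.
Proof.
pose linked (A : {set T}) := forall s t : {perm T}, s \notin S -> t \notin S -> agree_off A s t ->
  connect (avoiding (swap_rel eX eY) S) s t.
have vN: v \notin N by rewrite inE eX_irr.
have linked_star: linked (v |: N).
  move=> {}s {}t sS tS st.
  have := star_delete eY_sym eY_irr few_strangers vN Nq SN sS tS st.
  apply: connect_sub => r r' /and3P[/swap_rel_starP[a [aN va ->]] rS r'S].
  apply: connect_avoiding1 => //; apply: swap_rel_tperm => //.
  by rewrite inE in aN.
suff linkedT (A : {set T}) : v |: N \subset A -> linked A -> linked setT.
  by move=> sS tS; apply: (linkedT _ (subxx _) linked_star) => // x; rewrite inE.
move: {2}#|_| (leqnn #|~: A|) => k; elim: k A => [|k IHk] A Ak NA linkA.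
  suff <-: A = setT by [].
  by move: Ak; rewrite leqn0 cards_eq0 => /eqP A0; rewrite -[A]setCK A0 setC0.
have [<-//|AT] := eqVneq A setT.
have vA: v \in A by apply: (subsetP NA); apply: setU11.
have [w [x [wA xA wx]]] := exit_edge eX_sym eX_connected vA AT.
have cardA: #|N| < #|A|.
  by have := subset_leq_card NA; rewrite cardsU1 vN.
have SA: #|S| < #|A|.-1 by clear -SN cardA; lia.
apply: (IHk (x |: A)).
- rewrite -ltnS; apply: leq_trans Ak; rewrite [ltnRHS](cardsD1 x) inE xA ltnS.
  by apply: subset_leq_card; apply/subsetP=> y; rewrite !inE negb_or.
- exact: subset_trans NA (subsetUr _ _).
move=> {}s {}t sS tS st.
apply: (glue_blocks eY_sym eY_irr few_strangers (S := S) (bad := set0) xA wA) => //.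
- by clear -Nq cardA; lia.
- by rewrite cards0.
- exact: leq_trans SA (fact_geq _).
- by move=> r r' rS r'S rr' _; apply: linkA.
- by move=> r rS r'S rwx; apply: swap_connect.
- by rewrite in_set0.
- by rewrite in_set0.
Qed.

End SwapDeletion.

(** * Friends-and-strangers graphs *)

Lemma connect_delete (G : sgraph) (S : {set G}) (x y : delete S) :
  connect (avoiding (@adj G) S) (val x) (val y) -> connect (@adj (delete S)) x y.
Proof.
case/connectP=> p; elim: p x => [|z p IHp] x /=.
  by move=> _ /val_inj ->.
case/andP=> /and3P[xz _ zS] zp yE.
apply: connect_trans (IHp (Sub z zS) _ _); rewrite ?SubK //.
by apply: connect1; rewrite /= /delete_adj SubK.
Qed.

Lemma bijection_of_card (T U : finType) : #|T| = #|U| -> exists f : T -> U, bijective f.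
Proof.
move=> TU; exists (fun x => enum_val (cast_ord TU (enum_rank x))).
exists (fun y => enum_val (cast_ord (esym TU) (enum_rank y))) => x.
  by rewrite enum_valK cast_ordK enum_rankK.
by rewrite enum_valK cast_ordKV enum_rankK.
Qed.

Section FSAsSwaps.
Variables (X Y : sgraph) (g : X -> Y).
Hypothesis g_bij : bijective g.

Let g_inj : injective g := bij_inj g_bij.

Lemma bijectiveb_perm (p : {perm X}) : bijectiveb [ffun x => g (p x)].
Proof.
apply/andP; split.
  by apply/injectiveP=> x y; rewrite !ffunE => /g_inj/perm_inj.
have [h _ gK] := g_bij; apply/forallP=> y; apply/existsP.
by exists ((p^-1)%g (h y)); rewrite ffunE permKV gK.
Qed.

Definition state_of_perm (p : {perm X}) : FS X Y := Sub _ (bijectiveb_perm p).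

Lemma state_of_permE p x : val (state_of_perm p) x = g (p x).
Proof. by rewrite ffunE. Qed.

Lemma state_of_perm_inj : injective state_of_perm.
Proof.
move=> p r pr; apply/permP=> x; apply: g_inj.
by rewrite -!state_of_permE pr.
Qed.

Lemma state_of_perm_onto (s : FS X Y) : exists p, state_of_perm p = s.
Proof.
have [h hK gK] := g_bij; have /andP[/injectiveP s_inj _] := valP s.
have hs_inj : injective (fun x => h (val s x)).
  by move=> x y /(can_inj gK)/s_inj.
exists (perm hs_inj); apply/val_inj/ffunP=> x.
by rewrite state_of_permE permE gK.
Qed.

Lemma state_of_perm_adj (p r : {perm X}) :
  swap_rel (@adj X) (relpre g (@adj Y)) p r -> adj (state_of_perm p) (state_of_perm r).
Proof.
case/existsP=> a /existsP[b /and3P[ab /= pab /eqP->]].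
apply/existsP; exists a; apply/existsP; exists b.
rewrite !state_of_permE !permM tpermL tpermR ab pab !eqxx.
have -> /=: a != b by apply: contraTneq ab => ->; rewrite adj_irr.
apply/forallP=> c; apply/implyP=> /andP[ca cb].
by rewrite !state_of_permE permM tpermD // eq_sym.
Qed.

End FSAsSwaps.

(** The bound on [k] says that [k - 1] deleted states satisfy the hypothesis of
    [swap_delete]. *)
Theorem FS_k_connected (X Y : sgraph) (q k : nat) (v : X) :
    #|X| = #|Y| -> connected X ->
    (forall y : Y, #|[set z | ~~ adj y z]| <= q) ->
    q.*2 <= degree v -> k + maxn q.-1.*2 1 <= (degree v).+1 ->
  k_connected k (FS X Y).
Proof.
move=> XY [_ Xconn] few qv kv.
have [g g_bij] := bijection_of_card XY; have g_inj := bij_inj g_bij.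
pose st := @state_of_perm X Y g g_bij.
have st_inj: injective st by apply: state_of_perm_inj.
have degX: degree v < #|X|.
  rewrite -cardsT; apply: proper_card; apply/properP; split; first exact: subsetT.
  by exists v; rewrite // inE adj_irr.
have kFS: k < #|FS X Y|.
  have: #|{perm X}| <= #|FS X Y| by apply: (leq_card st).
  have <-: #|perm_on [set: X]| = #|{perm X}|.
    by apply: eq_card => p; rewrite !inE; apply/subsetP=> x; rewrite inE.
  rewrite card_perm cardsT; apply: leq_trans.
  apply: leq_trans (fact_geq _); clear -kv degX; lia.
split=> // S Sk; split.
  have [|x _ xS] := @exists_outside _ [set: FS X Y] S.
    by rewrite cardsT -ltnS Sk ltnW // ltnS.
  by apply/card_gt0P; exists (Sub x xS).
move=> x y; apply: connect_delete.
have [p xE] := state_of_perm_onto g_bij (val x).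
have [r yE] := state_of_perm_onto g_bij (val y).
pose S' := [set p | st p \in S].
have S'S: #|S'| <= #|S|.
  rewrite -(card_imset _ st_inj); apply: subset_leq_card.
  by apply/subsetP=> z /imsetP[p']; rewrite inE => + ->.
have S'v: #|S'| + maxn q.-1.*2 1 <= degree v by clear -S'S Sk kv; lia.
have: connect (avoiding (swap_rel (@adj X) (relpre g (@adj Y))) S') p r.
  apply: (swap_delete (q := q) (v := v)).
  - exact: adj_sym.
  - exact: adj_irr.
  - exact: Xconn.
  - by move=> a b; apply: adj_sym.
  - by move=> a; apply: adj_irr.
  - move=> a; apply: leq_trans (few (g a)); rewrite -(card_imset _ g_inj).
    by apply: subset_leq_card; apply/subsetP=> z /imsetP[b]; rewrite !inE => + ->.
  - exact: qv.
  - exact: S'v.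
  - by rewrite inE /st xE (valP x).
  - by rewrite inE /st yE (valP y).
rewrite -xE -yE; case/connectP=> l + ->; elim: l p {xE} => [|z l IHl] p //=.
case/andP=> /and3P[pz pS zS] zl; apply: connect_trans (IHl z zl).
move: pS zS; rewrite !inE => pS zS; apply: connect_avoiding1 => //.
exact: state_of_perm_adj.
Qed.

Lemma leq_min_degree (G : sgraph) (x : G) : min_degree G <= degree x.
Proof.
rewrite /min_degree; have: x \in index_enum G by rewrite mem_index_enum.
elim: (index_enum G) => // y r IHr; rewrite inE big_cons => /orP[/eqP<-|/IHr].
  exact: geq_minl.
exact/leq_trans/geq_minr.
Qed.

(** An edge leaving the closed neighbourhood of [v] starts at a neighbour of [v],
    which therefore has degree at least 2. *)
Lemma max_degree_gt1 (G : sgraph) : 2 < #|G| -> connected G -> 1 < max_degree G.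
Proof.
move=> G2 [G0 Gconn]; rewrite ltnNge; apply/negP=> D1.
have deg1 (x : G) : degree x <= 1 by apply: leq_trans (leq_bigmax x) D1.
have /card_gt0P[v _] := G0; pose A := v |: [set y | adj v y].
have AT: A != setT.
  apply: contraTneq G2 => AE; rewrite -cardsT -AE -leqNgt.
  by apply: leq_trans (leq_card_setU _ _) _; rewrite cards1 ltnS; apply: deg1.
have [w [x [wA xA wx]]] := exit_edge (@adj_sym G) Gconn (setU11 _ _ : v \in A) AT.
move: wA xA; rewrite !inE negb_or => /orP[/eqP wv|vw] /andP[xv vx].
  by rewrite -wv wx in vx.
have := deg1 w; rewrite leqNgt => /negP[].
by rewrite /degree (cardsD1 v) (cardsD1 x) !inE xv wx adj_sym vw.
Qed.

Lemma noncomplete_strangers (G : sgraph) n : #|G| = n ->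
  ~ graph_iso G (complete_graph n) -> exists x y : G, x != y /\ ~~ adj x y.
Proof.
move=> Gn noniso.
have [/existsP[x /existsP[y /andP[xy nxy]]]|all_adj] :=
  boolP [exists x : G, exists y : G, (x != y) && ~~ adj x y]; first by exists x, y.
case: noniso; exists (fun x => cast_ord Gn (enum_rank x)).
  exists (fun i => enum_val (cast_ord (esym Gn) i)) => x.
    by rewrite cast_ordK enum_rankK.
  by rewrite enum_valK cast_ordKV.
move=> x y; rewrite /= /complete_adj (inj_eq (@cast_ord_inj _ _ _)) (inj_eq enum_rank_inj).
have [->|xy] := eqVneq x y; first by rewrite adj_irr.
apply/esym/negPn/negP=> nxy; case/negP: all_adj.
by apply/existsP; exists x; apply/existsP; exists y; rewrite xy.
Qed.

Theorem theorem1p8 (s n : nat) (X Y : sgraph)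
    (hs : 2 <= s) (hn : 6 <= n)
    (hXn : #|X| = n) (hYn : #|Y| = n)
    (hX : connected X) (hY : connected Y) :
  (graph_iso Y (complete_graph n) -> k_connected (max_degree X) (FS X Y)) /\
  (~ graph_iso Y (complete_graph n) ->
   min_degree X <= min_degree Y ->
   2 * n + s - 2 <= max_degree X + 2 * min_degree Y ->
   k_connected s.+1 (FS X Y)).
Proof.
have XY: #|X| = #|Y| by rewrite hXn hYn.
have [v vD]: exists v : X, max_degree X = degree v.
  by case: hX => X0 _; have [v vD] := @eq_bigmax X (@degree X) X0; exists v.
split=> [[f f_bij fE]|noniso _ hD].
  have D2: 1 < max_degree X by apply: max_degree_gt1 => //; rewrite hXn; apply: leq_trans hn.
  apply: (FS_k_connected (q := 1) (v := v)) => //; rewrite -?vD //.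
    move=> y; rewrite -(cards1 y); apply: subset_leq_card; apply/subsetP=> z.
    by rewrite !inE -fE negbK => /eqP/(bij_inj f_bij) ->.
  by rewrite addn1.
have [y [y' [yy' nyy']]] := noncomplete_strangers hYn noniso.
have degC (z : Y) : degree z + #|[set u | ~~ adj z u]| = n.
  rewrite -hYn -(cardsC [set u | adj z u]); congr (_ + #|pred_of_set _|).
  by apply/setP=> u; rewrite !inE.
have y2: 1 < #|[set u | ~~ adj y u]|.
  by rewrite (cardsD1 y) (cardsD1 y') !inE adj_irr eq_sym yy' nyy'.
have dy := leq_min_degree y; have Cy := degC y.
apply: (FS_k_connected (q := n - min_degree Y) (v := v)) => //; rewrite -?vD.
- by move=> z; have := leq_min_degree z; have := degC z; clear; lia.
- by clear -hD hs dy Cy y2; lia.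
- by clear -hD hs dy Cy y2; lia.
Qed.
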